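(* Let $m$ be a (positive) multiple of $4$, let $(\pi,V)$ be a representation of $D_m$ with character $\chi_\pi$, put $r_c=r^{m/2}$, and set $$a_\pi=\tfrac14\big(\chi_\pi(1)-2\chi_\pi(rs)+\chi_\pi(r_c)\big),\quad b_\pi=\tfrac14\big(\chi_\pi(1)-2\chi_\pi(s)+\chi_\pi(r_c)\big),\quad c_\pi=\tfrac14\big(\chi_\pi(1)-\chi_\pi(r_c)\big).$$ Then $\pi$ lifts to: (i) $\widetilde{\mathrm{O}}(V)$ if and only if $a_\pi\equiv b_\pi\equiv c_\pi \pmod 2$; (ii) $\mathrm{Pin}^+(V)$ if and only if $c_\pi$ is even and $\binom{a_\pi}{2}\equiv\binom{b_\pi}{2}\equiv\binom{c_\pi}{2}\pmod 2$; (iii) $\mathrm{Pin}^-(V)$ if and only if $c_\pi$ is even and $\binom{a_\pi+1}{2}\equiv\binom{b_\pi+1}{2}\equiv\binom{c_\pi+1}{2}\pmod 2$.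
   Context: Representations are finite-dimensional complex representations. $D_m=\langle r,s\mid r^m=1,\ s^2=1,\ rs=sr^{-1}\rangle$ is the dihedral group of order $2m$. Every representation of $D_m$ is orthogonal, i.e. preserves a nondegenerate quadratic form $Q$ on its space $V$, so it gives a homomorphism $\pi:D_m\to\mathrm{O}(V)$. The numbers $a_\pi,b_\pi,c_\pi$ are non-negative integers. Double covers of $\mathrm{O}(V)$: $\widetilde{\mathrm{O}}(V)=\{(g,z)\in \mathrm{O}(V)\times C_4:\det g=z^2\}$, where $C_4\subset\mathbb{C}^\times$ is generated by the imaginary unit, with projection $(g,z)\mapsto g$. Let $C(V)$ be the Clifford algebra, the quotient of the tensor algebra $T(V)$ by the two-sided ideal generated by $\{v\otimes v-Q(v):v\in V\}$. $\mathrm{Pin}^+(V)$ (resp. $\mathrm{Pin}^-(V)$) is the subgroup of $C(V)^\times$ generated by the $u\in V$ with $Q(u)=1$ (resp. $Q(u)=-1$); the covering map to $\mathrm{O}(V)$ sends each such $u$ to the reflection in the hyperplane orthogonal to $u$, with kernel $\{\pm1\}$. ''$\pi$ lifts to $E$'' means there is a homomorphism $D_m\to E$ whose composition with the covering $E\to\mathrm{O}(V)$ is $\pi$. Known cohomological criterion, where $w_i(\pi)\in H^i(\cdot,\mathbb{Z}/2\mathbb{Z})$ are the Stiefel-Whitney classes of $\pi$ (pullbacks of the universal classes on $B\mathrm{O}(V)$): an orthogonal representation $\pi$ of a finite group lifts to $\widetilde{\mathrm{O}}(V)$ iff $w_1(\pi)^2=0$, to $\mathrm{Pin}^+(V)$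 iff $w_2(\pi)=0$, and to $\mathrm{Pin}^-(V)$ iff $w_2(\pi)+w_1(\pi)^2=0$. *)

(* Defs.v *)
From HB Require Import structures.
From mathcomp Require Import all_boot all_order all_algebra.
From mathcomp Require Import all_fingroup all_solvable.
From mathcomp Require Import mxrepresentation.
From mathcomp Require Import boolp reals.
From mathcomp Require Import complex.
From mathcomp Require Import monalg.
From mathcomp Require Import generic_quotient.

Set Implicit Arguments.
Unset Strict Implicit.
Unset Printing Implicit Defensive.

Import Order.TTheory GRing.Theory Num.Theory.
Local Open Scope quotient_scope.
Local Open Scope ring_scope.

(* For m > 1, 'D_(m.*2) has order 2m and is presented by these relations, so  *)
(* the pairs (r, s) below are exactly the images of the standard generators of *)
(* the dihedral group under its automorphisms.                                 *)
Definition dihedral_generators (m : nat) (r s : 'D_(m.*2)) : Prop :=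
  [/\ (<<[set r; s]>> = [set: 'D_(m.*2)])%g, (r ^+ m = 1)%g,
      (s ^+ 2 = 1)%g & (r * s = s * r^-1)%g].

Section QuadraticSpace.
Variables (K : fieldType) (n : nat).
Implicit Types (B A : 'M[K]_n) (u v : 'cV[K]_n).

(* The space is V = K^n, as column vectors; in characteristic other than 2 a   *)
(* quadratic form is encoded by its symmetric Gram matrix B. Matrices act on V *)
(* by A *m v.                                                                  *)
Definition qform B v : K := (v^T *m B *m v) 0 0.

Definition nondegenerate_form B : Prop := B^T = B /\ B \in unitmx.

Definition orthogonal_group B : {pred 'M[K]_n} :=
  [pred A | A^T *m B *m A == B].

(* v |-> v - 2 B(u, v) / Q(u) u, only used when Q(u) != 0. *)
Definition reflection B u : 'M[K]_n :=
  1%:M - (2 / qform B u) *: (u *m u^T *m B).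

End QuadraticSpace.

Section Clifford.
Variables (K : fieldType) (n : nat).
Implicit Types (B : 'M[K]_n) (u v : 'cV[K]_n).

(* The tensor algebra of K^n is the free associative algebra on the canonical  *)
(* basis: the word i_1 ... i_k stands for e_(i_1) (x) ... (x) e_(i_k).         *)
Definition tensor_algebra := {malg K[{fmonom 'I_n}]}.

HB.instance Definition _ := GRing.Lalgebra.on tensor_algebra.

Definition tensor_vec v : tensor_algebra :=
  \sum_(i < n) v i 0 *: mkmalgU (fmu i) 1.

Definition clifford_relator B v : tensor_algebra :=
  tensor_vec v * tensor_vec v - qform B v *: 1.

Definition clifford_ideal B : {pred tensor_algebra} :=
  fun x => `[< exists t : seq (tensor_algebra * 'cV[K]_n * tensor_algebra),
    x = \sum_(p <- t) p.1.1 * clifford_relator B p.1.2 * p.2 >].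

Lemma clifford_ideal_zmod B : zmod_closed (clifford_ideal B).
Proof.
split=> [|x y /asboolP[t ->] /asboolP[t' ->]]; apply/asboolP.
  by exists [::]; rewrite big_nil.
exists (t ++ [seq (- p.1.1, p.1.2, p.2) | p <- t']).
rewrite big_cat big_map -sumrN; congr (_ + _).
by apply: eq_bigr => p _; rewrite !mulNr.
Qed.

HB.instance Definition _ B :=
  GRing.isZmodClosed.Build tensor_algebra (clifford_ideal B)
    (clifford_ideal_zmod B).

Lemma clifford_idealMl B a x :
  x \in clifford_ideal B -> a * x \in clifford_ideal B.
Proof.
move=> /asboolP[t ->]; apply/asboolP.
exists [seq (a * p.1.1, p.1.2, p.2) | p <- t].
by rewrite big_map mulr_sumr; apply: eq_bigr => p _; rewrite !mulrA.
Qed.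

Lemma clifford_idealMr B a x :
  x \in clifford_ideal B -> x * a \in clifford_ideal B.
Proof.
move=> /asboolP[t ->]; apply/asboolP.
exists [seq (p.1.1, p.1.2, p.2 * a) | p <- t].
by rewrite big_map mulr_suml; apply: eq_bigr => p _; rewrite !mulrA.
Qed.

Lemma clifford_idealZ B (c : K) x :
  x \in clifford_ideal B -> c *: x \in clifford_ideal B.
Proof. by move=> xI; rewrite -[x]mul1r scalerAl clifford_idealMl. Qed.

Definition clifford B : Type :=
  Quotient.quot (GRing.ZmodClosed.clone _ (clifford_ideal B) _).

HB.instance Definition _ B := GRing.Zmodule.on (clifford B).
HB.instance Definition _ B := @Quotient.on (clifford B).

Definition clifford_pi B (x : tensor_algebra) : clifford B :=
  \pi_(clifford B) x.

Lemma clifford_piP B x y :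
  reflect (clifford_pi B x = clifford_pi B y) (x - y \in clifford_ideal B).
Proof. by rewrite Quotient.idealrBE; apply: eqP. Qed.

Lemma clifford_piK B : cancel repr (clifford_pi B).
Proof. exact: reprK. Qed.

Lemma clifford_piD B : {morph clifford_pi B : x y / x + y}.
Proof. exact: Quotient.pi_add. Qed.

Lemma clifford_reprK B x : repr (clifford_pi B x) - x \in clifford_ideal B.
Proof. by apply/clifford_piP; rewrite clifford_piK. Qed.

Definition clifford_one B : clifford B := clifford_pi B 1.

Definition clifford_mul B (x y : clifford B) : clifford B :=
  clifford_pi B (repr x * repr y).

Definition clifford_scale B (c : K) (x : clifford B) : clifford B :=
  clifford_pi B (c *: repr x).

Lemma clifford_piM B x y :
  clifford_pi B (x * y) = clifford_mul (clifford_pi B x) (clifford_pi B y).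
Proof.
apply/esym/clifford_piP; set x' := repr _; set y' := repr _.
have -> : x' * y' - x * y = x' * (y' - y) + (x' - x) * y.
  by rewrite mulrBr mulrBl addrA subrK.
apply: rpredD; first exact/clifford_idealMl/clifford_reprK.
exact/clifford_idealMr/clifford_reprK.
Qed.

Lemma clifford_piZ B c x :
  clifford_pi B (c *: x) = clifford_scale c (clifford_pi B x).
Proof.
by apply/esym/clifford_piP; rewrite -scalerBr clifford_idealZ ?clifford_reprK.
Qed.

Section Laws.
Variable B : 'M[K]_n.
Local Notation mul := (@clifford_mul B).
Local Notation scale := (@clifford_scale B).
Local Notation pi := (clifford_pi B).

Let ex (x : clifford B) : x = pi (repr x). Proof. by rewrite clifford_piK. Qed.

Lemma clifford_mulA : associative mul.
Proof.
by move=> x y z; rewrite (ex x) (ex y) (ex z) -!clifford_piM mulrA.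
Qed.

Lemma clifford_mul1 : left_id (clifford_one B) mul.
Proof. by move=> x; rewrite (ex x) -clifford_piM mul1r. Qed.

Lemma clifford_mulr1 : right_id (clifford_one B) mul.
Proof. by move=> x; rewrite (ex x) -clifford_piM mulr1. Qed.

Lemma clifford_mulDl : left_distributive mul +%R.
Proof.
move=> x y z; rewrite (ex x) (ex y) (ex z).
by rewrite -clifford_piD -!clifford_piM mulrDl clifford_piD.
Qed.

Lemma clifford_mulDr : right_distributive mul +%R.
Proof.
move=> x y z; rewrite (ex x) (ex y) (ex z).
by rewrite -clifford_piD -!clifford_piM mulrDr clifford_piD.
Qed.

Lemma clifford_scaleA a b x : scale a (scale b x) = scale (a * b) x.
Proof. by rewrite (ex x) -!clifford_piZ scalerA. Qed.

Lemma clifford_scale1 : left_id 1 scale.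
Proof. by move=> x; rewrite (ex x) -clifford_piZ scale1r. Qed.

Lemma clifford_scaleDr : right_distributive scale +%R.
Proof.
move=> a x y; rewrite (ex x) (ex y).
by rewrite -clifford_piD -!clifford_piZ scalerDr clifford_piD.
Qed.

Lemma clifford_scaleDl x : {morph scale^~ x : a b / a + b}.
Proof.
by move=> a b; rewrite (ex x) -!clifford_piZ scalerDl clifford_piD.
Qed.

Lemma clifford_scaleAl a x y : scale a (mul x y) = mul (scale a x) y.
Proof.
rewrite (ex x) (ex y).
by rewrite -clifford_piM -!clifford_piZ -clifford_piM scalerAl.
Qed.

End Laws.

(* Only a pzRingType: that 1 != 0 in the quotient is a theorem, which the      *)
(* definition of the Pin groups does not need. lalgType requires a nonzero     *)
(* ring, so the algebra structure is the lmodType one with clifford_scaleAl.   *)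
HB.instance Definition _ B := GRing.Zmodule_isPzRing.Build (clifford B)
  (@clifford_mulA B) (@clifford_mul1 B) (@clifford_mulr1 B)
  (@clifford_mulDl B) (@clifford_mulDr B).

HB.instance Definition _ B := GRing.Zmodule_isLmodule.Build K (clifford B)
  (@clifford_scaleA B) (@clifford_scale1 B)
  (@clifford_scaleDr B) (@clifford_scaleDl B).

Definition clifford_vec B v : clifford B := clifford_pi B (tensor_vec v).

Lemma clifford_vec_sqr B v :
  clifford_vec B v * clifford_vec B v = qform B v *: (1 : clifford B).
Proof.
transitivity (clifford_pi B (tensor_vec v * tensor_vec v)).
  by rewrite clifford_piM.
transitivity (clifford_pi B (qform B v *: 1)); last by rewrite clifford_piZ.
apply/clifford_piP/asboolP; exists [:: (1, v, 1)].
by rewrite big_seq1 mul1r mulr1.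
Qed.

End Clifford.

(* The subgroup of the unit group of E generated by S (meant for S consisting  *)
(* of units).                                                                  *)
Inductive generated_units (E : pzRingType) (S : E -> Prop) : E -> Prop :=
| generated_incl x : S x -> generated_units S x
| generated_one : generated_units S 1
| generated_mul x y :
    generated_units S x -> generated_units S y -> generated_units S (x * y)
| generated_inv x y :
    generated_units S x -> x * y = 1 -> y * x = 1 -> generated_units S y.

Section DoubleCovers.
Variables (C : numClosedFieldType) (n : nat).
Implicit Types (B g : 'M[C]_n).

(* Subset of the product ring 'M_n * C; its product is componentwise. *)
Definition O_tilde B : 'M[C]_n * C -> Prop := fun x =>
  [/\ x.1 \in orthogonal_group B, exists k, x.2 = 'i ^+ k
    & \det x.1 = x.2 ^+ 2].

Definition O_tilde_cover (x : 'M[C]_n * C) g : Prop := x.1 = g.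

(* Pin^+ is eps = 1 and Pin^- is eps = -1. *)
Definition Pin B (eps : C) : clifford B -> Prop :=
  generated_units (fun x => exists2 u, qform B u = eps & x = clifford_vec B u).

(* The graph of the covering homomorphism Pin -> O(V): the subgroup of         *)
(* C(V)^* x GL(V) generated by the pairs (u, reflection in u).                 *)
Definition Pin_cover B (eps : C) (x : clifford B) g : Prop :=
  generated_units (fun p : clifford B * 'M[C]_n =>
    exists2 u, qform B u = eps & p = (clifford_vec B u, reflection B u))
    (x, g).

(* E_grp is a group inside the ring E, and E_cover the graph of a homomorphism *)
(* from it to matrices.                                                        *)
Definition lifts (gT : finGroupType) (rho : gT -> 'M[C]_n) (E : pzRingType)
    (E_grp : E -> Prop) (E_cover : E -> 'M[C]_n -> Prop) : Prop :=
  exists f : gT -> E,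
    [/\ forall x y, f (x * y)%g = f x * f y, forall x, E_grp (f x)
      & forall x, E_cover (f x) (rho x)].

Definition lifts_O_tilde (gT : finGroupType) (rho : gT -> 'M[C]_n) B : Prop :=
  @lifts gT rho _ (O_tilde B) O_tilde_cover.

Definition lifts_Pin_plus (gT : finGroupType) (rho : gT -> 'M[C]_n) B : Prop :=
  @lifts gT rho _ (@Pin B 1) (@Pin_cover B 1).

Definition lifts_Pin_minus (gT : finGroupType) (rho : gT -> 'M[C]_n) B : Prop :=
  @lifts gT rho _ (@Pin B (-1)) (@Pin_cover B (-1)).

End DoubleCovers.

Definition rep_char (C : fieldType) (gT : finGroupType) (n : nat)
    (rho : gT -> 'M[C]_n) (g : gT) : C := \tr (rho g).

(* Main.v *)
(** Put t = rs and rc = r^(m/2). As 4 divides m, conjugating s or t by r^(m/4)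
    multiplies it by rc, so both have trace 0 on the (-1)-eigenspace of rc. Hence
    a, b, c are ranks of commuting idempotents, and the (-1)-eigenspaces of t, s
    and rc have dimensions a + c, b + c and 2c.

    The lift of an involution with (-1)-eigenspace of dimension k is, up to sign,
    the product of k orthogonal vectors of square eps = +1 or -1, and its square
    is eps^k (-1)^C(k,2). So the lifts S, T of s, t generate a lift of the
    dihedral group iff these signs are 1 for k = a + c and k = b + c and
    (TS)^m = 1; the choice of signs of S and T does not matter because m is even.
    Finally (TS)^m is the square of (TS)^(m/2), a lift of rc, i.e. (-1)^c. *)

Require Import Defs.
From HB Require Import structures.
From mathcomp Require Import all_boot all_order all_algebra.
From mathcomp Require Import all_fingroup all_solvable.
From mathcomp Require Import mxrepresentation.
From mathcomp Require Import reals complex.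
From mathcomp Require Import finmap monalg boolp ring zify.
From mathcomp Require Import generic_quotient.

Set Implicit Arguments.
Unset Strict Implicit.
Unset Printing Implicit Defensive.

Import GRing.Theory Num.Theory.
Local Open Scope ring_scope.

(** * The spinor representation *)

Section Spinor.
Variable K : numFieldType.

(* Symmetry of the matrices is what makes transposition play the role of the
   reversal anti-automorphism of the Clifford algebra in [rho_norm]. *)
Lemma gamma_matrices n : exists N (gamma : 'I_n -> 'M[K]_N.+1),
  (forall i, (gamma i)^T = gamma i) /\
  (forall i j, gamma i *m gamma j + gamma j *m gamma i = ((i == j)%:R * 2)%:M).
Proof.
elim: n => [|n [N [g [gT gM]]]]; first by exists 0%N, (fun=> 0); split => [[]|[]].
(* The new generator swaps two blocks; the old ones act on them as [g j] and [- g j], which makes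
   them anticommute with the swap. *)
pose h (i : 'I_n.+1) : 'M[K]_(N.+1 + N.+1) :=
  if unlift ord0 i is Some j then block_mx (g j) 0 0 (- g j)
  else block_mx 0 1%:M 1%:M 0.
have hT i : (h i)^T = h i.
  rewrite /h; case: unliftP => [k _|_]; rewrite tr_block_mx !trmx0.
    by rewrite [(- _)^T]linearN /= gT.
  by rewrite trmx1.
suff hM i j : h i *m h j + h j *m h i = ((i == j)%:R * 2)%:M.
  by exists (N + N.+1)%N, h; split; [exact: hT|exact: hM].
rewrite scalar_mx_block /h.
case: unliftP => [i' ->|->]; case: unliftP => [j' ->|->];
  rewrite !mulmx_block !(mulmx0, mul0mx, mul1mx, mulmx1, addr0, add0r)
  add_block_mx ?addr0 ?add0r ?(inj_eq lift_inj).
- by rewrite !mulmxN !mulNmx !opprK gM.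
- by rewrite subrr addNr /= mul0r raddf0.
- by rewrite subrr addNr /= mul0r raddf0.
by rewrite eqxx mul1r -[2]/(1 + 1) raddfD.
Qed.

(** Twice the square, with the summation indices exchanged in one copy, involves only
    anticommutators. *)
Lemma gamma_quadratic n N (g : 'I_n -> 'M[K]_N.+1) (a : 'I_n -> K) :
  (forall i j, g i *m g j + g j *m g i = ((i == j)%:R * 2)%:M) ->
  (\sum_i a i *: g i) *m (\sum_i a i *: g i) = (\sum_i a i ^+ 2)%:M.
Proof.
move=> gM; set G := \sum_i _.
have GG : G *m G = \sum_i \sum_j (a i * a j) *: (g i *m g j).
  rewrite {1}/G mulmx_suml; apply: eq_bigr => i _.
  rewrite mulmx_sumr; apply: eq_bigr => j _.
  by rewrite -scalemxAl -scalemxAr scalerA.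
have: G *m G + G *m G = 2 *: (\sum_i a i ^+ 2)%:M.
  rewrite {1}GG GG [X in _ + X]exchange_big -big_split /=.
  rewrite raddf_sum scaler_sumr; apply: eq_bigr => i _.
  rewrite -big_split (bigD1 i) //= -scalerDr gM eqxx big1 ?addr0.
    by rewrite !scale_scalar_mx /= mul1r expr2 mulrC.
  move=> j /negPf ji; rewrite mulrC [a j * a i]mulrC -scalerDr gM eq_sym ji.
  by rewrite mul0r raddf0 scaler0.
by rewrite -mulr2n -scaler_nat; apply: scalerI; rewrite pnatr_eq0.
Qed.

Section FreeMonoidLift.
Variables (I : choiceType) (S : nzRingType) (g : I -> S).

Definition fmonom_prod (w : {fmonom I}) : S := \prod_(i <- (w : seq I)) g i.

Lemma fmonom_prod_mmorphism : mmorphism fmonom_prod.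
Proof.
split; last by rewrite /fmonom_prod fm1 big_nil.
by move=> x y; rewrite /fmonom_prod fmM big_cat.
Qed.

HB.instance Definition _ :=
  isMultiplicative.Build _ _ fmonom_prod fmonom_prod_mmorphism.
End FreeMonoidLift.

(** Gives a matrix model in which distinct scalars stay distinct. Coordinates in the orthonormal
    basis [E], paired with the gamma matrices, satisfy the Clifford relation, so the induced map on
    the tensor algebra kills the ideal. *)
Lemma clifford_spinor n (B E : 'M[K]_n) : E^T *m B *m E = 1%:M -> B^T = B ->
  exists N (rho : clifford B -> 'M[K]_N.+1),
    [/\ rho 1 = 1, {morph rho : x y / x * y}, scalable rho
      & forall v, (rho (clifford_vec B v))^T = rho (clifford_vec B v)].
Proof.
move=> EBE BT; have [N [g [gT gM]]] := gamma_matrices n.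
have EBK : E *m (E^T *m B) = 1%:M by apply: mulmx1C.
have BE : B = (E^T *m B)^T *m (E^T *m B).
  by rewrite trmx_mul trmxK BT -mulmxA EBK mulmx1.
(* [E^T *m B] is the inverse of [E], so the coefficients are the coordinates of [v] in the columns
   of [E]. *)
pose G (v : 'cV_n) : 'M[K]_N.+1 := \sum_j (E^T *m B *m v) j 0 *: g j.
pose e i : 'cV[K]_n := delta_mx i 0.
pose F := mmap (S := 'M[K]_N.+1) (@scalar_mx _ _) (fmonom_prod (fun i => G (e i))).
(* Coefficients become scalar matrices; their centrality makes the extension multiplicative although
   the generators do not commute. *)
have comm_scalar (x : tensor_algebra K n) (m m' : {fmonom 'I_n}) :
    GRing.comm ((x@_m)%:M : 'M[K]_N.+1) (fmonom_prod (fun i => G (e i)) m').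
  exact/esym/scalar_mxC.
have [FM' F1'] := commr_mmap_is_multiplicative comm_scalar.
have FB x y : F (x - y) = F x - F y by apply: raddfB.
have FM x y : F (x * y) = F x * F y by apply: FM'.
have F1 : F 1 = 1 by apply: F1'.
have FZ c x : F (c *: x) = c *: F x by rewrite /F mmapZ /= -mul_scalar_mx.
have Fv v : F (tensor_vec v) = G v.
  rewrite /F /tensor_vec raddf_sum /=.
  under eq_bigr => i _ do rewrite -/F FZ /F mmapU /= mul1r /fmonom_prod fmU big_seq1.
  rewrite /G; under eq_bigr => i _ do rewrite scaler_sumr.
  rewrite exchange_big; apply: eq_bigr => j _ /=.
  rewrite [in RHS](_ : v = \sum_i v i 0 *: e i); last first.
    apply/colP => i; rewrite summxE (bigD1 i) //= !mxE !eqxx mulr1 big1 ?addr0 //.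
    by move=> k /negPf ki; rewrite !mxE eq_sym ki mulr0.
  rewrite mulmx_sumr summxE scaler_suml; apply: eq_bigr => i _.
  by rewrite -scalemxAr scalerA; congr (_ *: _); rewrite [RHS]mxE.
have Fq v : G v * G v = qform B v *: 1.
  rewrite -mulmxE gamma_quadratic // -[RHS]mul_scalar_mx mulmx1; congr (_%:M).
  rewrite /qform [in RHS]BE /G; set W := E^T *m B.
  rewrite [v^T *m _]mulmxA -(mulmxA _ W v) -trmx_mul [RHS]mxE.
  by apply: eq_bigr => i _; rewrite expr2 [(W *m v)^T _ _]mxE.
have FI x : x \in clifford_ideal B -> F x = 0.
  move=> /asboolP[t ->]; rewrite /F raddf_sum big1 // => p _.
  rewrite -[LHS]/(F (p.1.1 * clifford_relator B p.1.2 * p.2)).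
  rewrite !FM; have -> : F (clifford_relator B p.1.2) = 0.
    by rewrite FB FM FZ F1 Fv Fq subrr.
  by rewrite mulr0 mul0r.
have Fpi x : F (repr (clifford_pi B x)) = F x.
  by apply/eqP; rewrite -subr_eq0 -FB FI ?clifford_reprK.
exists N, (fun x => F (repr x)); split.
- by rewrite [1]/(clifford_pi B 1) Fpi F1.
- by move=> x y; rewrite [x * y]/(clifford_pi B (_ * _)) Fpi FM.
- by move=> c x; rewrite [c *: x]/(clifford_pi B (_ *: _)) Fpi FZ.
move=> v; rewrite Fpi Fv /G raddf_sum; apply: eq_bigr => i _.
by rewrite /= linearZ /= gT.
Qed.
End Spinor.

(** * Orthonormal eigenbases of orthogonal involutions *)

(** Polarization at a sum of two basis vectors gives [2 * M i j = 0]. *)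
Lemma quadratic_eq0 (K : numFieldType) n (M : 'M[K]_n) :
  M^T = M -> (forall w, qform M w = 0) -> M = 0.
Proof.
move=> MT M0; pose e i : 'cV[K]_n := delta_mx i 0.
have Mij i j : ((e i)^T *m M *m e j) 0 0 = M i j.
  by rewrite trmx_delta -rowE -colE !mxE.
apply/matrixP => i j; rewrite [RHS]mxE.
have Mji : M j i = M i j by rewrite -[in LHS]MT mxE.
have := M0 (e i + e j); rewrite /qform [(_ + _)^T]linearD /= !(mulmxDl, mulmxDr).
have addE (X Y : 'M[K]_1) : (X + Y) 0 0 = X 0 0 + Y 0 0 by rewrite mxE.
rewrite !addE; have := M0 (e i); have := M0 (e j); rewrite /qform !Mij => -> ->.
rewrite Mji add0r addr0 -mulr2n => /eqP.
by rewrite mulrn_eq0 /= => /eqP.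
Qed.

Section Orthobasis.
Variables (C : numClosedFieldType) (n : nat) (B g : 'M[C]_n).
Hypotheses (BT : B^T = B) (Bu : B \in unitmx).
Hypotheses (gO : g^T *m B *m g = B) (gg : g *m g = 1%:M).

(** Induction on [k]: [g] preserves the orthogonal complement of the vectors already found, and one
    of its eigenspaces there contains a non-isotropic vector, which is then normalized. *)
Lemma orthonormal_eigenvectors k : (k <= n)%N ->
  exists (E : 'M[C]_(n, k)) (d : 'rV[C]_k),
  [/\ E^T *m B *m E = 1%:M, g *m E = E *m diag_mx d
    & forall j, exists b : bool, d 0 j = (-1) ^+ b].
Proof.
elim: k => [_|k IHk lt_kn].
  by exists 0, 0; split; [apply/matrixP => [[]]|apply/matrixP => ? []|case].
have [E [d [EBE gE dE]]] := IHk (ltnW lt_kn).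
(* The orthogonal projection onto the complement of the column span of [E]. *)
pose P := 1%:M - E *m (E^T *m B).
have EBP : E^T *m B *m P = 0.
  by rewrite mulmxBr mulmx1 [_ *m (E *m _)]mulmxA EBE mul1mx subrr.
have PP : P *m P = P by rewrite {1}/P mulmxBl mul1mx -mulmxA EBP mulmx0 subr0.
have PB : P^T *m B = B *m P.
  rewrite /P [(_ - _)^T]linearB /= trmx1 !trmx_mul trmxK BT mulmxBl mulmxBr.
  by rewrite mul1mx mulmx1 !mulmxA.
have Bg : B *m g = g^T *m B by rewrite -[in LHS]gO -!mulmxA gg mulmx1.
have gP : g *m P = P *m g.
  rewrite /P mulmxBr mulmxBl mulmx1 mul1mx [g *m (E *m _)]mulmxA gE -!mulmxA Bg.
  rewrite [E^T *m (g^T *m _)]mulmxA -trmx_mul gE trmx_mul tr_diag_mx.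
  by rewrite !mulmxA.
(* [P = 0] would factor the identity through the [k < n] columns of [E]. *)
have BP0 : B *m P != 0.
  apply/eqP => BP0; have P0 : P = 0 by rewrite -[P](mulKmx Bu) BP0 mulmx0.
  have: \rank (E *m (E^T *m B)) = n.
    by move/eqP: P0; rewrite subr_eq0 => /eqP <-; rewrite mxrank1.
  by move=> rk; have := mulmx_max_rank E (E^T *m B); rewrite rk leqNgt lt_kn.
(* [S b] is twice the projection onto the eigenspace of [g] for [(-1) ^+ b]. *)
clearbody P; pose S (b : bool) := 1%:M + (-1) ^+ b *: g.
have gS b : g *m S b = (-1) ^+ b *: S b.
  rewrite /S mulmxDr mulmx1 -scalemxAr gg scalerDr scalerA addrC -expr2 sqrr_sign.
  by rewrite scale1r.
have SP b : S b *m P = P *m S b.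
  by rewrite /S mulmxDl mulmxDr mul1mx mulmx1 -scalemxAl gP scalemxAr.
have Sb b : (S b)^T *m B *m S b = 2 *: B + (-1) ^+ b *: (2 *: (B *m g)).
  rewrite /S [(_ + _)^T]linearD /= [(_ *: g)^T]linearZ /= trmx1 mulmxDl mul1mx.
  rewrite -scalemxAl -Bg mulmxDr mulmx1 -scalemxAr mulmxDl -scalemxAl -mulmxA gg.
  rewrite mulmx1 scalerDr scalerA -expr2 sqrr_sign scale1r.
  by rewrite !scaler_nat !mulr2n scalerDr [_ *: _ + B]addrC addrACA.
have SS : (S false)^T *m B *m S false + (S true)^T *m B *m S true = 4 *: B.
  by rewrite !Sb scale1r scaleN1r addrACA subrr addr0 -scalerDl -natrD.
(* Otherwise both eigenspaces of g on the complement P of the span of E are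
   isotropic, and B, being the sum of its restrictions, vanishes on P. *)
have [b [w qw]] : exists b w, qform B (S b *m P *m w) != 0.
  apply: contrapT => no; case/eqP: BP0.
  have Sb0 b : (S b *m P)^T *m B *m (S b *m P) = 0.
    apply: quadratic_eq0 => [|w].
      by rewrite !trmx_mul BT !trmxK !mulmxA.
    apply/eqP/negPn/negP => qw; case: no; exists b, w; move: qw.
    by rewrite /qform !trmx_mul !mulmxA.
  have : 4 *: (B *m P) = 0.
    rewrite -PP mulmxA -PB -mulmxA scalemxAr scalemxAl -SS mulmxDl mulmxDr.
    have := Sb0 false; have := Sb0 true; rewrite !trmx_mul !mulmxA => -> ->.
    by rewrite addr0.
  by move=> /eqP; rewrite scaler_eq0 pnatr_eq0 => /eqP.
pose v0 := S b *m P *m w; pose q := qform B v0.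
pose v := (sqrtC q)^-1 *: v0.
have vBv : v^T *m B *m v = 1%:M.
  apply/matrixP => i j; rewrite !ord1 [in RHS]mxE eqxx.
  rewrite /v [(_ *: _)^T]linearZ /= -!scalemxAl -scalemxAr scalerA [LHS]mxE.
  by rewrite -[X in _ * X]/(qform B v0) -/q -invfM -expr2 sqrtCK mulVf.
have EBv : E^T *m B *m v = 0.
  by rewrite /v -scalemxAr /v0 SP !mulmxA EBP !mul0mx scaler0.
have vBE : v^T *m B *m E = 0.
  by have := congr1 trmx EBv; rewrite !trmx_mul trmxK BT trmx0 mulmxA.
have gv : g *m v = v *m ((-1) ^+ b)%:M.
  rewrite mul_mx_scalar /v -scalemxAr /v0 !mulmxA gS -!scalemxAl !scalerA.
  by rewrite mulrC.
pose E' : 'M_(n, 1 + k) := row_mx v E.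
pose d' : 'rV_(1 + k) := row_mx ((-1) ^+ b)%:M d.
have EBE' : E'^T *m B *m E' = 1%:M.
  by rewrite tr_row_mx mul_col_mx mul_col_row vBv EBv vBE EBE -scalar_mx_block.
have gE' : g *m E' = E' *m diag_mx d'.
  rewrite diag_mx_row mul_row_block mul_mx_row gE gv !mulmx0 addr0 add0r.
  by congr (row_mx (_ *m _) _); apply/matrixP => i j; rewrite !ord1 !mxE eqxx.
exists E', d'; split=> //.
move=> j; rewrite mxE; case: splitP => // i _.
by exists b; rewrite ord1 mxE eqxx.
Qed.

(** The predicate [d] selects the basis vectors with eigenvalue -1, so [#|d|] is the dimension of
    that eigenspace. *)
Lemma involution_orthobasis : exists (E : 'M[C]_n) (d : pred 'I_n),
  [/\ E^T *m B *m E = 1%:M, forall j, g *m col j E = (-1) ^+ d j *: col j E,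
      \tr g = n%:R - 2 * #|d|%:R & \det g = (-1) ^+ #|d|].
Proof.
have [E [d0 [EBE gE dE]]] := orthonormal_eigenvectors (leqnn n).
have [d d0E] := choice dE.
have gEE : g = E *m diag_mx d0 *m (E^T *m B).
  by rewrite -gE -mulmxA (mulmx1C EBE) mulmx1.
exists E, d; split=> // [j||].
- rewrite [in LHS]colE mulmxA -colE gE mul_mx_diag.
  by apply/colP => i; rewrite !mxE d0E mulrC.
- rewrite gEE mxtrace_mulC mulmxA EBE mul1mx mxtrace_diag.
  transitivity (\sum_(i < n) (1 - 2 * (d i)%:R) : C).
    apply: eq_bigr => i _; rewrite d0E; case: (d i); rewrite ?mulr0 ?subr0 //.
    by rewrite mulr1 opprD addrA subrr sub0r.
  rewrite sumrB sumr_const card_ord -mulr_sumr; congr (_ - 2 * _).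
  by rewrite -natr_sum -big_mkcond sum1_card.
rewrite gEE det_mulmx (det_mulmx E) mulrAC -det_mulmx (mulmx1C EBE) det1 mul1r.
rewrite det_diag -prodr_const [RHS]big_mkcond; apply: eq_bigr => i _.
by rewrite d0E unfold_in; case: (d i).
Qed.

End Orthobasis.

(** * Products of Clifford generators *)

Lemma mulr_signCA (S : pzRingType) (x y : S) n :
  x * ((-1) ^+ n * y) = (-1) ^+ n * (x * y).
Proof. by rewrite mulrA commr_sign mulrA. Qed.

Section Anticommuting.
Variables (S : pzRingType) (I : eqType) (f : I -> S) (e : bool).
Hypotheses (ff : forall i, f i * f i = (-1) ^+ e).
Hypotheses (fC : forall i j, i != j -> f i * f j = - (f j * f i)).

Let word (w : seq I) := \prod_(i <- w) f i.

(** Each letter other than [i] contributes one sign, and their number has the parity of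
    [size w + count_mem i w]. *)
Lemma anticommuting_comm i w :
  f i * word w = (-1) ^+ (size w + count_mem i w) * (word w * f i).
Proof.
elim: w => [|j w IHw]; first by rewrite /word big_nil mulr1 !mul1r.
rewrite /word big_cons -/(word w) /=.
have -> : f i * (f j * word w) = (-1) ^+ (j != i) * (f j * (f i * word w)).
  rewrite !mulrA; congr (_ * _).
  have [->|ji] := eqVneq j i; first by rewrite mul1r.
  by rewrite fC 1?eq_sym //= mulN1r mulNr.
rewrite IHw mulr_signCA !mulrA -exprD; congr (_ * _ * _ * _).
by rewrite -signr_odd -[in RHS]signr_odd; congr (_ ^+ nat_of_bool _); case: eqP; lia.
Qed.

(** Moving the first letter past the rest costs one sign per remaining letter; these costs add up to
    the binomial coefficient. *)
Lemma anticommuting_sqr w : uniq w ->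
  word w * word w = (-1) ^+ (e * size w + 'C(size w, 2)).
Proof.
elim: w => [_|i w IHw /= /andP[iw /IHw ww]]; first by rewrite /word big_nil mulr1 muln0.
rewrite /word big_cons -/(word w) {1}anticommuting_comm (count_memPn iw) addn0.
rewrite -!mulrA [f i * _]mulrA ff mulr_signCA ww -!exprD; congr (_ ^+ _).
by rewrite binS bin1 mulnS; lia.
Qed.

(** The first letter occurs again later: bring the two copies together, cancel them up to sign, and
    recurse on the shorter word. *)
Lemma anticommuting_even w : (forall i, ~~ odd (count_mem i w)) ->
  ~~ odd (size w) /\ exists k, word w = (-1) ^+ k.
Proof.
have [k le_wk] := ubnP (size w); elim: k w le_wk => // k IHk [_ _|i w].
  by split=> //; exists 0%N; rewrite /word big_nil.
rewrite ltnS /= => wk ev.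
have: i \in w.
  by rewrite -has_pred1 has_count; move: (ev i); rewrite /= eqxx; case: count.
move=> /path.splitPr w_; case: w_ wk ev => p q wk ev.
have [|j|spq [l pq]] := IHk (p ++ q).
- by move: wk; rewrite !size_cat /=; lia.
- by move: (ev j); rewrite /= !count_cat /=; case: eqP => _; lia.
split; first by move: spq; rewrite !size_cat /=; lia.
exists (size p + count_mem i p + (e + l))%N.
rewrite /word big_cons big_cat big_cons mulrA anticommuting_comm -!mulrA [RHS]exprD.
congr (_ * _); rewrite [f i * (f i * _)]mulrA ff mulr_signCA [RHS]exprD; congr (_ * _).
by rewrite -pq /word big_cat.
Qed.
End Anticommuting.

Lemma malg_scalerAr (M : monomType) (R : comNzRingType) (c : R) (x y : {malg R[M]}) :
  c *: (x * y) = x * (c *: y).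
Proof.
apply/malgP => k; rewrite mcoeffZ mcoeffMl.
rewrite (mcoeffMlw _ (fsubset_refl _) (msuppZ_le c y)) mulr_sumr.
apply: eq_bigr => i _; rewrite mulr_sumr; apply: eq_bigr => j _.
by rewrite mcoeffZ mulrnAr mulrCA.
Qed.

(** * Scalars and vectors in the Clifford algebra *)

Section CliffordVec.
Variables (K : numFieldType) (n : nat) (B : 'M[K]_n).
Implicit Types (u v : 'cV[K]_n) (x y : clifford B).
Local Notation cv := (clifford_vec B).

Lemma clifford_vecD u v : cv (u + v) = cv u + cv v.
Proof.
rewrite /clifford_vec -[RHS]clifford_piD; congr (clifford_pi B _).
rewrite /tensor_vec -big_split; apply: eq_bigr => i _ /=.
by rewrite mxE scalerDl.
Qed.

Lemma clifford_vecZ a u : cv (a *: u) = a *: cv u.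
Proof.
rewrite /clifford_vec -[RHS]clifford_piZ; congr (clifford_pi B _).
rewrite /tensor_vec scaler_sumr; apply: eq_bigr => i _ /=.
by rewrite mxE scalerA.
Qed.

Lemma clifford_scalerAl a x y : a *: (x * y) = (a *: x) * y.
Proof. exact: clifford_scaleAl. Qed.

Lemma clifford_scalerAr a x y : a *: (x * y) = x * (a *: y).
Proof.
rewrite -[x]clifford_piK -[y]clifford_piK.
rewrite -[_ * _]clifford_piM -[LHS]clifford_piZ -[_ *: clifford_pi B _]clifford_piZ.
by rewrite -[RHS]clifford_piM malg_scalerAr.
Qed.

Definition clifford_scalar (a : K) : clifford B := a *: (1 : clifford B).

Lemma clifford_scalar_additive : zmod_morphism clifford_scalar.
Proof. by move=> a b; apply: scalerBl. Qed.

Lemma clifford_scalar_multiplicative : monoid_morphism clifford_scalar.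
Proof.
split=> [|a b]; first exact: scale1r.
transitivity (a *: clifford_scalar b); first exact/esym/scalerA.
rewrite -[RHS]clifford_scalerAl; congr (_ *: _).
exact/esym/mul1r.
Qed.

HB.instance Definition _ :=
  GRing.isZmodMorphism.Build K (clifford B) clifford_scalar clifford_scalar_additive.
HB.instance Definition _ :=
  GRing.isMonoidMorphism.Build K (clifford B) clifford_scalar
    clifford_scalar_multiplicative.

Lemma clifford_scalarE a x : clifford_scalar a * x = a *: x.
Proof. by rewrite -[LHS]clifford_scalerAl; congr (_ *: _); apply: mul1r. Qed.

Lemma clifford_scalarC a x : clifford_scalar a * x = x * clifford_scalar a.
Proof.
rewrite clifford_scalarE -[RHS]clifford_scalerAr; congr (_ *: _).
exact/esym/mulr1.
Qed.

Lemma clifford_vec_scale a u : cv (a *: u) = clifford_scalar a * cv u.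
Proof. by rewrite clifford_vecZ clifford_scalarE. Qed.

End CliffordVec.

Lemma eq_mulmx_cV (R : pzRingType) m n (A A' : 'M[R]_(m, n)) :
  (forall v : 'cV_n, A *m v = A' *m v) -> A = A'.
Proof.
move=> AA'; apply/matrixP => i k.
by have /colP/(_ i) := AA' (delta_mx k 0); rewrite -!colE !mxE.
Qed.

(** * The kernel of the Pin covering *)

(* Everything is done for a ring S with a central map sc of scalars and a Clifford
   map j of vectors, later taken to be [clifford B]: rewriting directly in the
   quotient makes unification unfold it. *)
Section CliffordMap.
Variables (C : numClosedFieldType) (n : nat) (B : 'M[C]_n).
Hypotheses (BT : B^T = B) (Bu : B \in unitmx).
Variables (S : pzRingType) (sc : {rmorphism C -> S}) (j : 'cV[C]_n -> S).
Hypotheses (scC : forall a x, sc a * x = x * sc a).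
Hypotheses (jD : forall u v, j (u + v) = j u + j v).
Hypotheses (jZ : forall a u, j (a *: u) = sc a * j u).
Hypotheses (jj : forall u, j u * j u = sc (qform B u)).
Variables (e : bool).
Implicit Types (u v : 'cV[C]_n) (us : seq 'cV[C]_n).
Local Notation eps := ((-1) ^+ e : C).
Local Notation refl := (reflection B).
Local Notation bil u v := ((u^T *m B *m v) 0 0).

Lemma scalarCA x a y : x * (sc a * y) = sc a * (x * y).
Proof. by rewrite mulrA -scC mulrA. Qed.

Lemma bilC u v : bil v u = bil u v.
Proof.
have -> : bil v u = (u^T *m B *m v)^T 0 0 by rewrite !trmx_mul trmxK BT mulmxA.
by rewrite mxE.
Qed.

Lemma qformD u v : qform B (u + v) = qform B u + 2 * bil u v + qform B v.
Proof.
have -> : qform B (u + v) = bil u u + bil v u + (bil u v + bil v v).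
  rewrite /qform [(_ + _)^T]linearD /= mulmxDl mulmxDr !mulmxDl.
  by rewrite [LHS]mxE [X in X + _]mxE [X in _ + X]mxE.
by rewrite bilC mulr_natl mulr2n !addrA.
Qed.

Lemma bilBZ u v c : bil u (v - c *: u) = bil u v - c * bil u u.
Proof.
rewrite mulmxBr -scalemxAr; move: (_ *m v) (_ *m u) => X Y.
by rewrite !mxE.
Qed.

Lemma qformZ a u : qform B (a *: u) = a ^+ 2 * qform B u.
Proof.
rewrite /qform [(_ *: u)^T]linearZ /= -!scalemxAl -scalemxAr scalerA -expr2.
by rewrite [LHS]mxE.
Qed.

Lemma clifford_polar u v : j u * j v + j v * j u = sc (2 * bil u v).
Proof.
have := jj (u + v); rewrite jD mulrDl !mulrDr !jj qformD !rmorphD -!addrA.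
by move=> /addrI; rewrite !addrA => /addIr.
Qed.

Lemma reflection_mul u v : qform B u = eps ->
  refl u *m v = v - (2 * eps * bil u v) *: u.
Proof.
move=> qu; rewrite /reflection qu invr_sign mulmxBl mul1mx -scalemxAl.
rewrite -!mulmxA [u^T *m (B *m v)]mulmxA [X in u *m X]mx11_scalar mul_mx_scalar.
by rewrite scalerA.
Qed.

(** By polarization [j u * j v] is a scalar minus [j v * j u], and [j u * j u = sc eps] absorbs that
    scalar into the reflected vector. *)
Lemma twisted_conj u v : qform B u = eps ->
  j u * j v = - (j (refl u *m v) * j u).
Proof.
move=> qu; rewrite reflection_mul // -scaleNr jD jZ mulrDl -mulrA jj qu -rmorphM.
apply/eqP; rewrite -addr_eq0 addrA clifford_polar -rmorphD.
rewrite mulNr [2 * eps * _]mulrAC -(mulrA _ eps) -expr2 sqrr_sign mulr1.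
by rewrite subrr rmorph0.
Qed.

Lemma reflection_scale a u : a != 0 -> refl (a *: u) = refl u.
Proof.
move=> a0; rewrite /reflection qformZ [(a *: u)^T]linearZ /=.
rewrite -!scalemxAl -!scalemxAr -scalemxAl !scalerA.
congr (_ - _ *: _); rewrite -expr2 -mulrA invfM [_^-1 * _ * _]mulrAC.
by rewrite mulVf ?expf_neq0 // mul1r.
Qed.

Lemma reflection_sqr u : qform B u = eps -> refl u *m refl u = 1%:M.
Proof.
move=> qu; apply: eq_mulmx_cV => v; rewrite mul1mx -mulmxA !reflection_mul //.
rewrite bilBZ -[(u^T *m B *m u) 0 0]/(qform B u) qu mulrAC -!mulrA -expr2 sqrr_sign.
rewrite mulr1; set b := bil u v; rewrite -addrA -opprD -scalerDl.
by rewrite [X in X *: u](_ : _ = 0) ?scale0r ?subr0 //; ring.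
Qed.

Definition refl_pair u : S * 'M[C]_n := (j u, refl u).

(** The abstract form of [Pin_cover]: as a group of pairs in a product ring, the graph of the
    covering is handled like the group itself. *)
Definition cover : S * 'M[C]_n -> Prop :=
  generated_units (fun p => exists2 u, qform B u = eps & p = refl_pair u).

Lemma prod_refl_pair us :
  \prod_(u <- us) refl_pair u = (\prod_(u <- us) j u, \prod_(u <- us) refl u).
Proof. by elim: us => [|u us IH]; rewrite ?big_nil // !big_cons IH. Qed.

Let unit_vectors us := forall u, u \in us -> qform B u = eps.

(** The inverse of a generator [u] is [eps *: u], which has the same norm and the same reflection;
    the inverse product runs in reverse order. *)
Lemma prod_refl_pair_inv us : unit_vectors us -> exists2 us', unit_vectors us' &
  \prod_(u <- us) refl_pair u * \prod_(u <- us') refl_pair u = 1.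
Proof.
elim: us => [_|u us IH usP]; first by exists [::]; rewrite // !big_nil mulr1.
have [v vus|us' us'P prod1] := IH; first by apply: usP; rewrite inE vus orbT.
have qu : qform B u = eps by rewrite usP ?mem_head.
exists (rcons us' (eps *: u)) => [v|].
  rewrite mem_rcons inE => /predU1P[->|/us'P //].
  by rewrite qformZ sqrr_sign mul1r.
rewrite big_cons -cats1 big_cat big_seq1 /= -mulrA [X in _ * X]mulrA prod1 mul1r.
congr (_, _) => /=; last first.
  by rewrite reflection_scale ?signr_eq0 //; apply: reflection_sqr.
by rewrite jZ mulrA -scC -mulrA jj qu -rmorphM -expr2 sqrr_sign rmorph1.
Qed.

Lemma cover_prod x g : cover (x, g) -> exists us,
  [/\ unit_vectors us, x = \prod_(u <- us) j u & g = \prod_(u <- us) refl u].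
Proof.
suff coverP p : cover p ->
    exists2 us, unit_vectors us & p = \prod_(u <- us) refl_pair u.
  by move=> /coverP[us usP]; rewrite prod_refl_pair => -[-> ->]; exists us.
elim=> {p} [p [u qu ->]||p q _ [us usP ->] _ [vs vsP ->]|].
- by exists [:: u]; rewrite ?big_seq1 // => v /[!inE] /eqP ->.
- by exists [::]; rewrite ?big_nil.
- exists (us ++ vs); last by rewrite big_cat.
  by move=> u; rewrite mem_cat => /orP[/usP|/vsP].
move=> p q _ [us usP ->] _ qp; have [us' us'P pus] := prod_refl_pair_inv usP.
by exists us' => //; rewrite -[LHS]mulr1 -[in LHS]pus mulrA qp mul1r.
Qed.

Lemma prod_twisted us v : unit_vectors us ->
  (\prod_(u <- us) j u) * j v =
  (-1) ^+ size us * (j ((\prod_(u <- us) refl u) *m v) * \prod_(u <- us) j u).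
Proof.
elim: us v => [|u us IH] v usP.
  by rewrite !big_nil mul1r mulr1 [1 *m v]mul1mx mul1r.
rewrite !big_cons -mulrA IH => [|w wus]; last by rewrite usP // inE wus orbT.
rewrite mulr_signCA mulrA twisted_conj ?usP ?mem_head // exprS mulN1r mulNr.
by rewrite [refl u *m (_ *m v)]mulmxA mulNr mulrN !mulrA.
Qed.

Lemma cover_prod_refl_pair us : unit_vectors us ->
  cover (\prod_(u <- us) refl_pair u).
Proof.
elim: us => [|u us IH] usP; first by rewrite big_nil; apply: generated_one.
rewrite big_cons; apply: generated_mul.
  by apply: generated_incl; exists u; rewrite ?usP ?mem_head.
by apply: IH => v vus; rewrite usP // inE vus orbT.
Qed.

(** * Elements covering the identity, by averaging over an orthonormal basis *)

Section Averaging.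
Variable E : 'M[C]_n.
Hypothesis EBE : E^T *m B *m E = 1%:M.

Let f i := j (col i E).
Let word w := \prod_(i <- w) f i.

Lemma bil_basis i k : bil (col i E) (col k E) = (i == k)%:R.
Proof.
have -> : (col i E)^T *m B *m col k E =
    delta_mx 0 i *m (E^T *m B *m E) *m delta_mx k 0.
  by rewrite !colE trmx_mul trmx_delta !mulmxA.
by rewrite EBE -rowE -colE !mxE.
Qed.

Lemma basis_sqr i : f i * f i = (-1) ^+ false.
Proof. by rewrite /f jj /qform bil_basis eqxx rmorph1. Qed.

Lemma basis_anticommute i k : i != k -> f i * f k = - (f k * f i).
Proof.
move=> /negPf ik; apply/eqP; rewrite -addr_eq0 clifford_polar bil_basis ik.
by rewrite mulr0 rmorph0.
Qed.

Lemma basis_expansion v : v = \sum_i (E^T *m B *m v) i 0 *: col i E.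
Proof.
rewrite -[LHS]mul1mx -(mulmx1C EBE) -(mulmxA E); move: (_ *m v) => a.
apply/colP => k; rewrite summxE mxE; apply: eq_bigr => i _.
by rewrite !mxE mulrC.
Qed.

(* Averaging the k-twisted conjugations by the basis vectors fixes the elements
   covering 1 and kills the words of length k in which some basis vector occurs
   an odd number of times; the other words are signs. *)
Definition average k (l : seq 'I_n) (x : S) : S :=
  foldr (fun i y => sc 2^-1 * (y + (-1) ^+ k * (f i * y * f i))) x l.

Lemma average_sum k l (I : finType) (a : I -> C) (x : I -> S) :
  average k l (\sum_i sc (a i) * x i) = \sum_i sc (a i) * average k l (x i).
Proof.
elim: l => //= i l ->; rewrite mulr_sumr mulr_suml mulr_sumr -big_split mulr_sumr.
apply: eq_bigr => k' _ /=; set y := average _ _ _.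
rewrite [f i * _]scalarCA -[X in _ ^+ k * X]mulrA [_ ^+ k * _]scalarCA.
by rewrite -mulrDr scalarCA.
Qed.

Lemma half_double (x : S) : sc 2^-1 * (x + x) = x.
Proof.
rewrite -mulr2n -[x *+ 2]mulr_natl -(rmorph_nat sc 2) mulrA -rmorphM.
by rewrite mulVf ?pnatr_eq0 // rmorph1 mul1r.
Qed.

Lemma average_id k l x : (forall i, f i * x * f i = (-1) ^+ k * x) ->
  average k l x = x.
Proof.
move=> fx; elim: l => //= i l ->.
by rewrite fx mulrA -expr2 -exprM mulnC exprM sqrrN expr1n expr1n mul1r half_double.
Qed.

(** Twisted conjugation by [f i] multiplies the word by [(-1) ^+ count_mem i w], so an odd count
    averages to 0. *)
Lemma average_word l w : average (size w) l (word w) =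
  if all (fun i => ~~ odd (count_mem i w)) l then word w else 0.
Proof.
elim: l => //= i l ->; case: all; last by rewrite andbF !(mulr0, mul0r, addr0).
have -> : (-1) ^+ size w * (f i * word w * f i) = (-1) ^+ count_mem i w * word w.
  rewrite (anticommuting_comm basis_anticommute) -!mulrA basis_sqr mulr1.
  by rewrite mulrA -exprD addnA addnn -signr_odd oddD odd_double signr_odd.
rewrite andbT -signr_odd; case: odd; last by rewrite mul1r half_double.
by rewrite mulN1r subrr mulr0.
Qed.

Lemma average_prod us w : let k := (size w + size us)%N in
  exists a : C, average k (enum 'I_n) (word w * \prod_(u <- us) j u) = sc a
    /\ (odd k -> a = 0).
Proof.
elim: us w => [|u us IH] w /=.
  rewrite big_nil mulr1 addn0 average_word.
  case: allP => [ev|_]; last by exists 0; rewrite rmorph0.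
  have [|/negPf sw [l wl]] := anticommuting_even basis_sqr basis_anticommute (w := w).
    by move=> i; apply: ev; rewrite mem_enum.
  by exists ((-1) ^+ l); rewrite rmorph_sign -wl sw.
have /choice[b bP] i : exists a, average (size w + (size us).+1) (enum 'I_n)
    (word (rcons w i) * \prod_(u <- us) j u) = sc a /\
    (odd (size w + (size us).+1) -> a = 0).
  by have [a] := IH (rcons w i); rewrite size_rcons addSnnS; exists a.
pose a i := (E^T *m B *m u) i 0.
exists (\sum_i a i * b i); split; last first.
  by move=> kodd; rewrite big1 // => i _; rewrite (bP i).2 ?mulr0.
rewrite rmorph_sum big_cons.
have -> : word w * (j u * \prod_(v <- us) j v) =
    \sum_i sc (a i) * (word (rcons w i) * \prod_(v <- us) j v).
  have -> : j u = \sum_i sc (a i) * f i.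
    rewrite {1}[u]basis_expansion -/a.
    rewrite (big_morph j jD (_ : j 0 = 0)); last first.
      by rewrite -(scale0r 0) jZ rmorph0 mul0r.
    by apply: eq_bigr => i _; rewrite jZ.
  rewrite mulr_suml mulr_sumr; apply: eq_bigr => i _.
  by rewrite /word -cats1 big_cat big_seq1 !mulrA -scC.
by rewrite average_sum; apply: eq_bigr => i _; rewrite (bP i).1 rmorphM.
Qed.

(** By [prod_twisted], a product covering 1 is fixed by every twisted conjugation, so it equals its
    average. *)
Lemma cover1_scalar us : unit_vectors us -> \prod_(u <- us) refl u = 1 ->
  exists a, \prod_(u <- us) j u = sc a /\ (odd (size us) -> a = 0).
Proof.
move=> usP r1; have [a []] := average_prod us [::]; rewrite /word big_nil mul1r.
rewrite average_id => [-> aP|i]; first by exists a.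
by rewrite -mulrA prod_twisted // r1 [1 *m _]mul1mx mulr_signCA mulrA basis_sqr mul1r.
Qed.

Variables (N : nat) (rho : S -> 'M[C]_N.+1).
Hypotheses (rho1 : rho 1 = 1) (rhoM : {morph rho : x y / x * y}).
Hypothesis (rhoS : forall a, rho (sc a) = a%:M).
Hypothesis (rhoT : forall v, (rho (j v))^T = rho (j v)).

(** Transposition reverses the product, so the vectors cancel in pairs from the middle, each leaving
    a factor [eps]. *)
Lemma rho_norm us : unit_vectors us ->
  rho (\prod_(u <- us) j u) * (rho (\prod_(u <- us) j u))^T = (eps ^+ size us)%:M.
Proof.
elim: us => [|u us IH] usP; first by rewrite big_nil rho1 trmx1 mulr1.
rewrite big_cons rhoM -mulmxE trmx_mul rhoT mulmxA -[_ *m _ *m (rho _)^T]mulmxA.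
rewrite !mulmxE IH => [|w wus]; last by rewrite usP // inE wus orbT.
rewrite -mulmxE mul_mx_scalar -scalemxAl mulmxE -rhoM jj usP ?mem_head // rhoS.
by rewrite scale_scalar_mx exprSr.
Qed.

Lemma scalar_inj : injective sc.
Proof.
by move=> a b /(congr1 rho); rewrite !rhoS => /matrixP/(_ 0 0); rewrite !mxE.
Qed.

(** The scalar [a] satisfies [a ^+ 2 = eps ^+ size us]. Odd length would force [a = 0], so the right
    side is 1. *)
Lemma cover1 x : cover (x, 1) -> exists k, x = (-1) ^+ k.
Proof.
move=> /cover_prod[us [usP xE /esym r1]].
have [a [xa aP]] := cover1_scalar usP r1.
have := rho_norm usP; rewrite xa rhoS tr_scalar_mx -mulmxE -scalar_mxM.
move=> /matrixP/(_ 0 0); rewrite !mxE -expr2 => aa.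
case: (boolP (odd (size us))) => [/aP a0|/negPf ev].
  by move: aa; rewrite a0 expr0n => /esym/eqP; rewrite -exprM signr_eq0.
move: aa; rewrite -exprM -signr_odd oddM ev andbF expr0.
move=> /eqP; rewrite sqrf_eq1 xE xa => /orP[]/eqP ->.
  by exists 0%N; rewrite rmorph1.
by exists 1%N; rewrite rmorphN1.
Qed.

Lemma cover_uniq x y g : cover (x, g) -> cover (y, g) -> exists k, y = (-1) ^+ k * x.
Proof.
move=> /cover_prod[us [usP xE gE]] yg.
have [vs vsP usvs] := prod_refl_pair_inv usP.
have [ws wsP vsws] := prod_refl_pair_inv vsP.
(* Comparing with an inverse of the inverse shows that [vs] inverts [us] on both sides. *)
have usws : \prod_(u <- us) refl_pair u = \prod_(u <- ws) refl_pair u.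
  by rewrite -[LHS]mulr1 -[X in _ * X]vsws mulrA usvs mul1r.
have := vsws; rewrite -usws !prod_refl_pair -xE -gE => -[vx vg].
have := usvs; rewrite !prod_refl_pair -xE -gE => -[xv gv].
have := generated_mul yg (cover_prod_refl_pair vsP); rewrite prod_refl_pair.
rewrite -[_ * _]/(y * \prod_(u <- vs) j u, g * \prod_(u <- vs) refl u) gv.
by move=> /cover1[k yk]; exists k; rewrite -yk -mulrA vx mulr1.
Qed.

End Averaging.

(** * Lifts of involutions as products of basis vectors *)

Section BasisProducts.
Variables (E : 'M[C]_n) (c : C).
Hypotheses (EBE : E^T *m B *m E = 1%:M) (cc : c ^+ 2 = eps).

Let w k := c *: col k E.

Lemma basis_unit k : qform B (w k) = eps.
Proof. by rewrite qformZ cc /qform (bil_basis EBE) eqxx mulr1. Qed.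

Lemma prod_basis_reflection l i : uniq l ->
  (\prod_(k <- l) refl (w k)) *m col i E = (-1) ^+ (i \in l) *: col i E.
Proof.
elim: l => [|k l IH] /=; first by rewrite big_nil [1 *m _]mul1mx scale1r.
move=> /andP[kl /IH li]; rewrite big_cons -[_ *m _]mulmxA li -scalemxAr.
rewrite reflection_mul ?basis_unit // [(w k)^T]linearZ /= -!scalemxAl.
have -> : (c *: ((col k E)^T *m B *m col i E)) 0 0 = c * (k == i)%:R.
  by rewrite -(bil_basis EBE) mxE.
rewrite inE eq_sym; have [<-|_] := eqVneq k i; last by rewrite !mulr0 scale0r subr0.
rewrite (negPf kl) /w scalerA mulr1 -!mulrA -expr2 cc -expr2 sqrr_sign mulr1.
by rewrite scale1r scaleN1r -[X in X - _]scale1r -scalerBl -opprB addrK scaleN1r.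
Qed.

Lemma prod_basis_sqr l : uniq l ->
  (\prod_(k <- l) j (w k)) * (\prod_(k <- l) j (w k)) =
  (-1) ^+ (e * size l + 'C(size l, 2)).
Proof.
apply: anticommuting_sqr => [k|k i ki]; first by rewrite jj basis_unit rmorph_sign.
apply/eqP; rewrite -addr_eq0 clifford_polar [(w k)^T]linearZ /= -!scalemxAl.
rewrite -scalemxAr scalerA.
have -> : ((c * c) *: ((col k E)^T *m B *m col i E)) 0 0 = c * c * (k == i)%:R.
  by rewrite -(bil_basis EBE) mxE.
by rewrite (negPf ki) !mulr0 rmorph0.
Qed.

End BasisProducts.

(** The lift is the product of the suitably scaled eigenvectors for -1, and [k] is their number. *)
Lemma cover_involution g : g^T *m B *m g = B -> g *m g = 1%:M ->
  exists k x, [/\ cover (x, g), x * x = (-1) ^+ (e * k + 'C(k, 2))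
    & \tr g = n%:R - 2 * k%:R].
Proof.
move=> gO gg; have [E [d [EBE gE trg _]]] := involution_orthobasis BT Bu gO gg.
(* Scaling by a square root of [eps] turns the orthonormal eigenvectors into generators of norm
   [eps]. *)
pose c := sqrtC eps; have cc : c ^+ 2 = eps by rewrite sqrtCK.
exists #|d|, (\prod_(k <- enum d) j (c *: col k E)); split=> //; last first.
  by rewrite prod_basis_sqr ?enum_uniq // -cardE.
have -> : g = \prod_(k <- enum d) refl (c *: col k E).
  apply: eq_mulmx_cV => v; rewrite (basis_expansion EBE v) !mulmx_sumr.
  apply: eq_bigr => i _; rewrite -!scalemxAr gE.
  by rewrite prod_basis_reflection ?enum_uniq // mem_enum.
have := @cover_prod_refl_pair [seq c *: col k E | k <- enum d].
rewrite prod_refl_pair !big_map; apply=> _ /mapP[k _ ->].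
exact: basis_unit EBE cc k.
Qed.

End CliffordMap.

(** * Specialization to the Clifford algebra *)

Section PinGroup.
Variables (C : numClosedFieldType) (n : nat) (B : 'M[C]_n).
Hypotheses (BT : B^T = B) (Bu : B \in unitmx).
Implicit Types (x : clifford B) (g : 'M[C]_n).

Lemma Pin_involution (e : bool) g : g^T *m B *m g = B -> g *m g = 1%:M ->
  exists k x, [/\ Pin_cover ((-1) ^+ e) x g, x * x = (-1) ^+ (e * k + 'C(k, 2))
    & \tr g = n%:R - 2 * k%:R].
Proof.
move=> gO gg.
exact: (cover_involution BT Bu (sc := clifford_scalar B) (@clifford_vecD C n B)
  (clifford_vec_sqr B) e gO gg).
Qed.

Lemma clifford_orthobasis : exists E : 'M[C]_n, E^T *m B *m E = 1%:M.
Proof.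
have [||E [d []]] := @involution_orthobasis C n B 1%:M BT Bu; last by exists E.
  by rewrite trmx1 mul1mx mulmx1.
by rewrite mulmx1.
Qed.

(** The spinor representation has positive dimension and maps scalars to scalar matrices, so 1 and
    -1 differ in the Clifford algebra. *)
Lemma clifford_sign_inj a b : (-1) ^+ a = (-1) ^+ b :> clifford B -> odd a = odd b.
Proof.
have [E EBE] := clifford_orthobasis.
have [N [rho [rho1 rhoM rhoZ rhoT]]] := clifford_spinor EBE BT.
rewrite -(rmorph_sign (@clifford_scalar C n B)) -(rmorph_sign (@clifford_scalar C n B)).
have rhoS c : rho (clifford_scalar B c) = c%:M.
  by rewrite rhoZ rho1 scalemx1.
by move=> /(scalar_inj rhoS); rewrite -signr_odd -[RHS]signr_odd => /signr_inj.
Qed.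

Lemma Pin_cover_uniq (e : bool) x y g : Pin_cover ((-1) ^+ e) x g ->
  Pin_cover ((-1) ^+ e) y g -> exists k, y = (-1) ^+ k * x.
Proof.
have [E EBE] := clifford_orthobasis.
have [N [rho [rho1 rhoM rhoZ rhoT]]] := clifford_spinor EBE BT.
have rhoS c : rho (clifford_scalar B c) = c%:M.
  by rewrite rhoZ rho1 scalemx1.
apply: (cover_uniq BT (@clifford_scalarC C n B) (@clifford_vecD C n B)
  (@clifford_vec_scale C n B) (clifford_vec_sqr B) EBE rho1 rhoM rhoS rhoT).
Qed.

(** Any lift differs by a sign from the one built on eigenvectors, and the sign squares away; the
    trace determines [k]. *)
Lemma Pin_cover_sqr (e : bool) x g : g^T *m B *m g = B -> g *m g = 1%:M ->
  Pin_cover ((-1) ^+ e) x g -> forall k, \tr g = n%:R - 2 * k%:R ->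
  x * x = (-1) ^+ (e * k + 'C(k, 2)).
Proof.
move=> gO gg xg k trg; have [k' [y [yg yy trg']]] := Pin_involution e gO gg.
have <- : k' = k.
  move: trg'; rewrite trg => /addrI/oppr_inj/mulfI; rewrite pnatr_eq0 => /(_ isT).
  by move=> /eqP; rewrite eqr_nat => /eqP.
have [l ->] := Pin_cover_uniq yg xg.
by rewrite -mulrA mulr_signCA yy mulrA -expr2 sqrr_sign mul1r.
Qed.

Lemma Pin_cover_Pin eps x g : Pin_cover eps x g -> Pin eps x.
Proof.
rewrite /Pin_cover; set p := (x, g); rewrite -[x]/p.1; move: p => {x g} p.
elim=> {p} [_ [u qu ->]||p q _ pP _ qP|p q _ pP pq qp].
- by apply: generated_incl; exists u.
- exact: generated_one.
- exact: generated_mul.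
apply: generated_inv pP _ _.
  exact: (congr1 fst pq).
exact: (congr1 fst qp).
Qed.

End PinGroup.

(** * Dihedral groups *)

Lemma inverting_involutionX (gT : finGroupType) (x r : gT) k :
  (x * x = 1)%g -> (x * r * x = r^-1)%g -> (x * r ^+ k * x = r ^- k)%g.
Proof.
move=> xx xrx; elim: k => [|k IH]; first by rewrite !expg0 mulg1 xx invg1.
rewrite [in LHS]expgSr [in RHS]expgS invMg -IH -xrx !mulgA.
by rewrite -[(_ * x * x)%g]mulgA xx mulg1.
Qed.

Section Dihedral.
Variables (m : nat) (r s : 'D_(m.*2)).
Hypotheses (m_gt1 : (1 < m)%N) (hrs : dihedral_generators r s).

Lemma dihedral_mulss : (s * s = 1)%g.
Proof. by case: hrs => _ _ + _; rewrite expgS expg1. Qed.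

Lemma dihedral_conj : (s * r * s = r^-1)%g.
Proof.
case: hrs => _ _ _ rs; apply: (mulgI s); rewrite !mulgA dihedral_mulss mul1g.
exact: rs.
Qed.

(** Since [s] normalizes the cyclic group of [r], the two cyclic groups multiply to the whole
    group. *)
Lemma dihedral_form g : exists i k, g = (r ^+ i * s ^+ k)%g.
Proof.
have: g \in (<[r]> * <[s]>)%g.
  rewrite -norm_joinEr; last first.
    rewrite cycle_subG; apply/normP; rewrite -cycleJ conjgE.
    have -> : (s^-1 = s)%g by apply: (mulgI s); rewrite mulgV dihedral_mulss.
    by rewrite mulgA dihedral_conj cycleV.
  by case: hrs => rsG _ _ _; rewrite joing_idl joing_idr /joing rsG inE.
by case/mulsgP => _ _ /cycleP[i ->] /cycleP[k ->] ->; exists i, k.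
Qed.

Lemma dihedral_expg_mod i k : (r ^+ i * s ^+ k = r ^+ (i %% m) * s ^+ (k %% 2))%g.
Proof. by case: hrs => _ rm s2 _; rewrite !expg_mod. Qed.

(** The map from the [2m] pairs of residues onto a group of order [2m] is surjective, hence
    injective. *)
Lemma dihedral_form_uniq i k i' k' : (r ^+ i * s ^+ k = r ^+ i' * s ^+ k')%g ->
  i = i' %[mod m] /\ k = k' %[mod 2].
Proof.
pose phi (p : 'I_m * 'I_2) : 'D_(m.*2) := (r ^+ p.1 * s ^+ p.2)%g.
have m0 : (0 < m)%N by apply: ltnW.
pose red i k : 'I_m * 'I_2 :=
  (Ordinal (ltn_pmod i m0), Ordinal (ltn_pmod k (isT : (0 < 2)%N))).
have phiE x y : phi (red x y) = (r ^+ x * s ^+ y)%g by rewrite [RHS]dihedral_expg_mod.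
have /image_injP phi_inj : #|image phi predT| == #|{: 'I_m * 'I_2}|.
  apply/eqP; transitivity #|[set: 'D_(m.*2)]|; last first.
    by rewrite card_dihedral // card_prod !card_ord muln2.
  apply: eq_card => g.
  rewrite inE; have [x [y ->]] := dihedral_form g.
  by rewrite -phiE; apply/imageP; exists (red x y).
rewrite -!phiE => /phi_inj => /(_ isT isT) [ii kk].
by split.
Qed.

(** The normal form defines the map, and both sides rewrite by the same exchange rule. In the ring
    [E], the power [R ^+ m.-1] stands for the inverse of [R]. *)
Lemma dihedral_lift (E : pzRingType) (R S : E) :
    R ^+ m = 1 -> S * S = 1 -> S * R = R ^+ m.-1 * S ->
  exists f : 'D_(m.*2) -> E, (forall x y, f (x * y)%g = f x * f y) /\
    forall g, exists i k, g = (r ^+ i * s ^+ k)%g /\ f g = R ^+ i * S ^+ k.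
Proof.
move=> Rm SS SR.
have Rmod i : R ^+ i = R ^+ (i %% m) by rewrite expr_mod.
have Smod k : S ^+ k = S ^+ (k %% 2) by rewrite expr_mod.
(* The exponent of the rotation after moving [s ^+ k] past it; [m.-1 * i] represents [- i] modulo
   [m]. *)
pose c i k := if odd k then (m.-1 * i)%N else i.
have SRX i k : S ^+ k * R ^+ i = R ^+ (c i k) * S ^+ k.
  rewrite Smod modn2 /c; case: odd; last by rewrite expr0 mul1r mulr1.
  rewrite expr1 mulnC; elim: i => [|i IH]; first by rewrite !mul0n mulr1 mul1r.
  by rewrite exprSr mulrA IH -mulrA SR mulrA -exprD mulSnr.
have srX i k : (s ^+ k * r ^+ i = r ^+ (c i k) * s ^+ k)%g.
  case: hrs => _ rm s2 _; rewrite -(expg_mod k s2) modn2 /c.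
  case: odd; last by rewrite expg0 mul1g mulg1.
  rewrite expg1; transitivity (s * r ^+ i * s * s)%g.
    by rewrite -[RHS]mulgA dihedral_mulss mulg1.
  rewrite (inverting_involutionX _ dihedral_mulss dihedral_conj); congr (_ * _)%g.
  apply: (mulIg (r ^+ i)%g); rewrite mulVg -expgD -mulSnr prednK; last exact: ltnW.
  by rewrite expgM rm expg1n.
have /choice[ik ikP] g : exists p : nat * nat, g = (r ^+ p.1 * s ^+ p.2)%g.
  by have [i [k ->]] := dihedral_form g; exists (i, k).
pose f g := R ^+ (ik g).1 * S ^+ (ik g).2.
have fE i k : f (r ^+ i * s ^+ k)%g = R ^+ i * S ^+ k.
  have [ii kk] := dihedral_form_uniq (ikP (r ^+ i * s ^+ k)%g).
  by rewrite /f Rmod Smod -ii -kk -Rmod -Smod.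
exists f; split=> [x y|g]; last by exists (ik g).1, (ik g).2; rewrite -ikP.
rewrite {1}(ikP x) {1}(ikP y) -mulgA [(s ^+ _ * _)%g]mulgA srX !mulgA -expgD -mulgA.
rewrite -expgD fE /f exprD [in LHS]exprD -!mulrA; congr (_ * _).
by rewrite [RHS]mulrA SRX mulrA.
Qed.
End Dihedral.

(** * Ranks of idempotents and determinants of involutions *)

Section Involutions.
Variables (C : numClosedFieldType) (n : nat).
Implicit Types (P Q e : 'M[C]_n).

(** In a full-rank factorization [e = D *m R], idempotence forces [R *m D = 1%:M], whose trace is
    the rank. *)
Lemma mxtrace_idempotent e : e *m e = e -> \tr e = (\rank e)%:R.
Proof.
move=> ee; rewrite -[in LHS](mulmx_base e) mxtrace_mulC.
suff RD k (D : 'M_(n, k)) (R : 'M_(k, n)) :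
    row_full D -> row_free R -> D *m R = e -> R *m D = 1%:M.
  by rewrite (RD _ _ _ (col_base_full e) (row_base_free e) (mulmx_base e)) mxtrace1.
move=> /row_fullP[L LD] /row_freeP[M RM] DR; rewrite -DR in ee.
transitivity (L *m (D *m R *m (D *m R)) *m M).
  by rewrite !mulmxA LD mul1mx -mulmxA RM mulmx1.
by rewrite ee mulmxA LD mul1mx RM.
Qed.

(** The number is the rank of the projection [e] onto the common eigenspace where [P] is 1 and [Q]
    is -1. *)
Lemma commuting_involutions_rank P Q :
  P *m P = 1%:M -> Q *m Q = 1%:M -> P *m Q = Q *m P ->
  exists k : nat, k%:R = (n%:R + \tr P - \tr Q - \tr (P *m Q)) / 4.
Proof.
move=> PP QQ PQ; pose e := 4^-1 *: ((1%:M + P) *m (1%:M - Q)).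
exists (\rank e); rewrite -mxtrace_idempotent.
  rewrite mxtraceZ mulmxDl mul1mx mulmxBr mulmx1 !raddfD !raddfN /= mxtrace1.
  by rewrite mulrC; congr (_ / _); ring.
have QP : (1%:M - Q) *m (1%:M + P) = (1%:M + P) *m (1%:M - Q).
  rewrite mulmxDr mulmx1 mulmxBl mul1mx.
  by rewrite [in RHS]mulmxDl mul1mx mulmxBr mulmx1 PQ.
have P2 : (1%:M + P) *m (1%:M + P) = 2 *: (1%:M + P).
  rewrite mulmxDl mul1mx mulmxDr mulmx1 PP [X in _ + X]addrC.
  by rewrite scaler_nat mulr2n.
have Q2 : (1%:M - Q) *m (1%:M - Q) = 2 *: (1%:M - Q).
  rewrite mulmxBl mul1mx mulmxBr mulmx1 QQ -[X in _ - X]opprB opprK.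
  by rewrite scaler_nat mulr2n.
rewrite /e -scalemxAl -scalemxAr scalerA mulmxA -(mulmxA (1%:M + P)) QP.
rewrite mulmxA P2 -mulmxA Q2 -scalemxAl -scalemxAr !scalerA; congr (_ *: _).
by rewrite -natrM -mulrA mulVf ?mulr1 // pnatr_eq0.
Qed.

Lemma involution_det (B g : 'M[C]_n) k : B^T = B -> B \in unitmx ->
  g^T *m B *m g = B -> g *m g = 1%:M -> \tr g = n%:R - 2 * k%:R ->
  \det g = (-1) ^+ k.
Proof.
move=> BT Bu gO gg trg; have [E [d [_ _ trg' ->]]] := involution_orthobasis BT Bu gO gg.
move: trg'; rewrite trg => /addrI/oppr_inj/mulfI; rewrite pnatr_eq0 => /(_ isT).
by move=> /eqP; rewrite eqr_nat => /eqP ->.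
Qed.
End Involutions.

(** [S * T] is the inverse of [T * S]; this supplies the exchange relation required by
    [dihedral_lift]. *)
Lemma involutions_mul_inv (E : pzRingType) (S T : E) m : (0 < m)%N ->
  S * S = 1 -> T * T = 1 -> (T * S) ^+ m = 1 ->
  S * (T * S) = (T * S) ^+ m.-1 * S.
Proof.
move=> m_gt0 SS TT TSm.
have -> : (T * S) ^+ m.-1 = S * T.
  have TSST : T * S * (S * T) = 1 by rewrite mulrA -(mulrA T) SS mulr1 TT.
  by rewrite -[LHS]mulr1 -TSST mulrA -exprSr prednK // TSm mul1r.
by rewrite mulrA.
Qed.

(** * Representations of dihedral groups *)

Lemma divn2_double m : (4 %| m)%N -> (m %/ 2 + m %/ 2 = m)%N.
Proof. lia. Qed.

Lemma divn4_double m : (4 %| m)%N -> (m %/ 4 + m %/ 4 = m %/ 2)%N.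
Proof. lia. Qed.

Lemma bin2D a b : 'C(a + b, 2) = ('C(a, 2) + 'C(b, 2) + a * b)%N.
Proof.
elim: a => [|a IH]; first by rewrite bin0n mul0n addn0.
rewrite addSn !binS !bin1 IH mulSn.
by move: (binomial _ _) (binomial _ _) (a * b)%N => x y z; lia.
Qed.

Section DihedralRepresentation.
Variables (C : numClosedFieldType) (m : nat).
Hypotheses (m_gt0 : (0 < m)%N) (h4m : (4 %| m)%N).
Variables (r s : 'D_(m.*2)).
Hypotheses (hrs : dihedral_generators r s).
Variables (n : nat) (rho : mx_representation C [set: 'D_(m.*2)]%g n) (B : 'M[C]_n).
Hypotheses (BT : B^T = B) (Bu : B \in unitmx).
Hypotheses (hrho : forall g : 'D_(m.*2), rho g \in orthogonal_group B).
Local Notation t := (r * s)%g.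
Local Notation rc := (r ^+ (m %/ 2))%g.

Let m_gt1 : (1 < m)%N. Proof. by have := dvdn_leq m_gt0 h4m; lia. Qed.

Let rhoM x y : rho (x * y)%g = rho x *m rho y.
Proof. by rewrite repr_mxM ?inE. Qed.

Let rho_orth g : (rho g)^T *m B *m rho g = B.
Proof. exact/eqP/hrho. Qed.

Let rho_invol g : (g * g = 1)%g -> rho g *m rho g = 1%:M.
Proof. by move=> gg; rewrite -rhoM gg repr_mx1. Qed.

Let ss : (s * s = 1)%g. Proof. exact: dihedral_mulss hrs. Qed.

Let tt : (t * t = 1)%g.
Proof. by rewrite -!mulgA [(s * _)%g]mulgA (dihedral_conj hrs) mulgV. Qed.

Let rcrc : (rc * rc = 1)%g.
Proof. by case: hrs => _ rm _ _; rewrite -expgD divn2_double. Qed.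

Let trK : (t * s = r)%g. Proof. by rewrite -mulgA ss mulg1. Qed.

Lemma trace_mul_rc x : (x * x = 1)%g -> (x * r * x = r^-1)%g ->
  \tr (rho x *m rho rc) = \tr (rho x).
Proof.
(* Conjugating [x] by [q] gives [x * q ^+ 2 = x * rc], and the trace is invariant. *)
move=> xx xrx; pose q := (r ^+ (m %/ 4))%g.
have xqx : (x * q = q^-1 * x)%g.
  by rewrite -(inverting_involutionX _ xx xrx) -mulgA xx mulg1.
have qq : (q * q = rc)%g by rewrite /q -expgD divn4_double.
have -> : rho x *m rho rc = rho (q^-1 * x * q)%g by rewrite -xqx -mulgA qq rhoM.
by rewrite -mulgA rhoM mxtrace_mulC -rhoM -mulgA mulgV mulg1.
Qed.

Let srs : (s * r * s = r^-1)%g. Proof. exact: dihedral_conj hrs. Qed.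

Let trt : (t * r * t = r^-1)%g.
Proof.
have -> : (t * r * t = r * (s * r ^+ 2 * s))%g by rewrite expgS expg1 !mulgA.
by rewrite (inverting_involutionX _ ss srs) expgS expg1 invMg mulKVg.
Qed.

(** Both numbers are dimensions inside the eigenspace of [x] for -1: [b] where [rc] acts as 1, and
    [c] where it acts as -1, the latter obtained by replacing [rho rc] with its opposite. *)
Lemma multiplicities x : (x * x = 1)%g -> (x * r * x = r^-1)%g ->
  (exists b : nat, b%:R = (n%:R - 2 * \tr (rho x) + \tr (rho rc)) / 4) /\
  (exists c : nat, c%:R = (n%:R - \tr (rho rc)) / 4).
Proof.
move=> xx xrx; have trx := trace_mul_rc xx xrx.
have rcx : rho rc *m rho x = rho x *m rho rc.
  rewrite -!rhoM; congr (rho _); apply: (mulgI x).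
  rewrite !mulgA (inverting_involutionX _ xx xrx) xx mul1g.
  by apply: (mulgI rc); rewrite mulgV rcrc.
have PP := rho_invol rcrc; have QQ := rho_invol xx.
have [b bE] := commuting_involutions_rank PP QQ rcx.
have [c cE] : exists c : nat, c%:R =
    (n%:R + \tr (- rho rc) - \tr (rho x) - \tr (- rho rc *m rho x)) / 4.
  apply: commuting_involutions_rank => //; first by rewrite mulmxN mulNmx opprK.
  by rewrite mulmxN mulNmx rcx.
split; [exists b; rewrite bE|exists c; rewrite cE].
  by rewrite rcx trx; congr (_ / _); ring.
by rewrite mulNmx !raddfN /= rcx trx; congr (_ / _); ring.
Qed.

Lemma character_multiplicities : exists a b c : nat,
  [/\ a%:R = (n%:R - 2 * \tr (rho t) + \tr (rho rc)) / 4,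
      b%:R = (n%:R - 2 * \tr (rho s) + \tr (rho rc)) / 4
    & c%:R = (n%:R - \tr (rho rc)) / 4].
Proof.
have [[a aE] _] := multiplicities tt trt; have [[b bE] [c cE]] := multiplicities ss srs.
by exists a, b, c.
Qed.

(** * Lifting criteria in terms of eigenspace dimensions *)

Section Lifting.
Variables a b c : nat.
Hypotheses (trt2 : \tr (rho t) = n%:R - 2 * (a + c)%:R).
Hypotheses (trs2 : \tr (rho s) = n%:R - 2 * (b + c)%:R).
Hypotheses (trrc2 : \tr (rho rc) = n%:R - 2 * (c + c)%:R).

Lemma lifts_O_tildeE : lifts_O_tilde rho B <-> ~~ odd (a + c) /\ ~~ odd (b + c).
Proof.
have detE x k : (x * x = 1)%g -> \tr (rho x) = n%:R - 2 * k%:R ->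
    \det (rho x) = (-1) ^+ k.
  by move=> xx; apply: involution_det BT Bu (rho_orth x) (rho_invol xx).
split=> [[f [fM fO fcov]]|[act bct]].
  (* A lift is only required to be multiplicative; the second component at 1 is an idempotent power
     of ['i], hence 1. *)
  have f1 : (f 1%g).2 = 1.
    have [_ [k fk] _] := fO 1%g.
    have f0 : (f 1%g).2 != 0 by rewrite fk expf_neq0 ?neq0Ci.
    apply: (mulfI f0); rewrite mulr1 -[in RHS](mulg1 1%g) fM; exact: erefl.
  have ev x k : (x * x = 1)%g -> \tr (rho x) = n%:R - 2 * k%:R -> ~~ odd k.
    move=> xx trx; have [_ _] := fO x; rewrite [(f x).1]fcov (detE _ _ xx trx).
    have -> : (f x).2 ^+ 2 = 1 by rewrite expr2 -[RHS]f1 -xx fM.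
    move=> k1; have /signr_inj-> // : (-1) ^+ odd k = (-1) ^+ false :> C.
    by rewrite signr_odd.
  by split; [apply: ev trt2|apply: ev trs2].
have det1 g : \det (rho g) = 1.
  have dett : \det (rho t) = 1 by rewrite (detE _ _ tt trt2) -signr_odd (negPf act).
  have dets : \det (rho s) = 1 by rewrite (detE _ _ ss trs2) -signr_odd (negPf bct).
  have detr : \det (rho r) = 1 by rewrite -trK rhoM det_mulmx dett dets mulr1.
  have detX x k : \det (rho x) = 1 -> \det (rho (x ^+ k)%g) = 1.
    move=> dx; elim: k => [|k IH]; first by rewrite repr_mx1 det1.
    by rewrite expgS rhoM det_mulmx dx IH mulr1.
  have [i [k ->]] := dihedral_form hrs g.
  by rewrite rhoM det_mulmx !detX // mulr1.
exists (fun g => (rho g, 1)); split=> // [x y|x].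
  by rewrite rhoM -[RHS]/(_, _) mulr1.
split=> //=; first by exists 0%N; rewrite expr0.
by rewrite det1 expr1n.
Qed.

Lemma lifts_PinE (e : bool) :
  lifts rho (@Pin _ _ B ((-1) ^+ e)) (@Pin_cover _ _ B ((-1) ^+ e)) <->
  [/\ ~~ odd c, ~~ odd (e * (a + c) + 'C(a + c, 2))
     & ~~ odd (e * (b + c) + 'C(b + c, 2))].
Proof.
(* ['C(c + c, 2)] is twice ['C(c, 2)] plus [c * c], so it has the parity of [c]. *)
have oddc : odd (e * (c + c) + 'C(c + c, 2)) = odd c.
  rewrite bin2D !addnn oddD oddM odd_double andbF /= oddD odd_double oddM.
  by rewrite andbb.
have sqrE x (y : clifford B) k : (x * x = 1)%g -> Pin_cover ((-1) ^+ e) y (rho x) ->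
    \tr (rho x) = n%:R - 2 * k%:R -> y * y = (-1) ^+ (e * k + 'C(k, 2)).
  move=> xx yx trx.
  exact: (Pin_cover_sqr BT Bu (rho_orth x) (rho_invol xx) yx trx).
split=> [[f [fM _ fcov]]|[cev aev bev]].
  (* The identity is an involution with [k = 0], so the square formula gives [f 1 * f 1 = 1], while
     multiplicativity makes this product [f 1]. *)
  have f1 : f 1%g = 1.
    rewrite -(mulg1 1%g) fM (sqrE _ _ 0%N (mulg1 _) (fcov _)) ?muln0 //.
    by rewrite repr_mx1 mxtrace1 mulr0 subr0.
  have ev x k : (x * x = 1)%g -> \tr (rho x) = n%:R - 2 * k%:R ->
      ~~ odd (e * k + 'C(k, 2)).
    move=> xx /(sqrE _ _ _ xx (fcov x)); rewrite -fM xx f1 => /esym.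
    by move/(clifford_sign_inj BT Bu (b := 0)) => ->.
  by split; [rewrite -oddc; apply: ev trrc2|apply: ev trt2|apply: ev trs2].
have [ks [S [Sc _ _]]] := Pin_involution BT Bu e (rho_orth s) (rho_invol ss).
have [kt [T [Tc _ _]]] := Pin_involution BT Bu e (rho_orth t) (rho_invol tt).
have even1 k : ~~ odd k -> (-1) ^+ k = 1 :> clifford B.
  by move=> /negPf ev; rewrite -signr_odd ev.
have SS : S * S = 1 by rewrite (sqrE _ _ _ ss Sc trs2) even1.
have TT : T * T = 1 by rewrite (sqrE _ _ _ tt Tc trt2) even1.
have coverM (x y : clifford B) g h : Pin_cover ((-1) ^+ e) x (rho g) ->
    Pin_cover ((-1) ^+ e) y (rho h) -> Pin_cover ((-1) ^+ e) (x * y) (rho (g * h)%g).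
  by rewrite rhoM => xg yh; apply: generated_mul xg yh.
have coverX (x : clifford B) g k : Pin_cover ((-1) ^+ e) x (rho g) ->
    Pin_cover ((-1) ^+ e) (x ^+ k) (rho (g ^+ k)%g).
  move=> xg; elim: k => [|k IH]; last by rewrite exprS expgS; apply: coverM.
  by rewrite repr_mx1; apply: generated_one.
pose R := T * S.
have Rc : Pin_cover ((-1) ^+ e) R (rho r) by rewrite -trK; apply: coverM.
have Rm : R ^+ m = 1.
  rewrite -(divn2_double h4m) exprD (sqrE _ _ _ rcrc (coverX _ _ _ Rc) trrc2).
  by rewrite even1 // oddc.
have SR := involutions_mul_inv m_gt0 SS TT Rm.
have [f [fM fE]] := dihedral_lift m_gt1 hrs Rm SS SR.
have fc g : Pin_cover ((-1) ^+ e) (f g) (rho g).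
  by have [i [k [-> ->]]] := fE g; apply: coverM; apply: coverX.
exists f; split; [exact: fM|move=> g; exact: Pin_cover_Pin (fc g)|exact: fc].
Qed.
End Lifting.
End DihedralRepresentation.

Theorem corollary1p5 (R : realType) (m : nat) (hm : (0 < m)%N)
    (h4m : (4 %| m)%N) (r s : 'D_(m.*2)) (hrs : dihedral_generators r s)
    (n : nat) (rho : mx_representation R[i] [set: 'D_(m.*2)]%g n)
    (B : 'M[R[i]]_n) (hB : nondegenerate_form B)
    (hrho : forall g : 'D_(m.*2), rho g \in orthogonal_group B) :
  let chi := rep_char rho in
  let rc := (r ^+ (m %/ 2))%g in
  exists a b c : nat,
    [/\ a%:R = (chi 1%g - 2 * chi (r * s)%g + chi rc) / 4,
        b%:R = (chi 1%g - 2 * chi s + chi rc) / 4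
      & c%:R = (chi 1%g - chi rc) / 4] /\
    [/\ lifts_O_tilde rho B <-> (a = b %[mod 2] /\ b = c %[mod 2])%N,
        lifts_Pin_plus rho B <->
          [/\ ~~ odd c, 'C(a, 2) = 'C(b, 2) %[mod 2]
            & 'C(b, 2) = 'C(c, 2) %[mod 2]]%N
      & lifts_Pin_minus rho B <->
          [/\ ~~ odd c, 'C(a.+1, 2) = 'C(b.+1, 2) %[mod 2]
            & 'C(b.+1, 2) = 'C(c.+1, 2) %[mod 2]]%N].
Proof.
move=> chi rc; have [BT Bu] := hB.
have [a [b [c [aE bE cE]]]] := character_multiplicities h4m hrs rho.
have chi1 : chi 1%g = n%:R by rewrite /chi /rep_char repr_mx1 mxtrace1.
exists a, b, c; rewrite chi1; split=> //.
(* Here [k + c] equals [(n - chi x) / 2], the multiplicity of the eigenvalue -1. *)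
have trE x k : k%:R = (n%:R - 2 * chi x + chi rc) / 4 ->
    \tr (rho x) = n%:R - 2 * (k + c)%:R.
  by rewrite natrD cE => ->; rewrite -/(chi x) -/(chi rc); field.
have trrcE : \tr (rho rc) = n%:R - 2 * (c + c)%:R.
  by rewrite natrD cE -/(chi rc); field.
have LO := lifts_O_tildeE hrs BT Bu hrho (trE _ _ aE) (trE _ _ bE).
have LP := lifts_PinE hm h4m hrs BT Bu hrho (trE _ _ aE) (trE _ _ bE) trrcE.
split.
- rewrite LO !modn2 !oddD.
  by case: (odd a); case: (odd b); case: (odd c); split=> [] [].
(* For even [c] the cross term [a * c] of ['C(a + c, 2)] drops out modulo 2. *)
- apply: iff_trans (LP false) _; rewrite !mul0n !add0n !bin2D !modn2 !oddD !oddM.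
  case: (odd c); rewrite ?andbF ?addbF; first by split=> [] [].
  case: (odd (binomial a 2)); case: (odd (binomial b 2));
  by case: (odd (binomial c 2)); split=> [] [].
(* The extra summand [a + c] turns ['C(a + c, 2)] into ['C((a + c).+1, 2)], whence the shifted
   binomials. *)
apply: iff_trans (LP true) _; rewrite !mul1n !binS !bin1 !bin2D !modn2 !oddD !oddM.
case: (odd c); rewrite ?andbF ?addbF; first by split=> [] [].
case: (odd (binomial a 2)); case: (odd (binomial b 2));
case: (odd (binomial c 2)); by case: (odd a); case: (odd b); split=> [] [].
Qed.
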